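(* Let $\mathcal L$ be a noncommutative solvable Lie algebra of dimension $4$ over $\mathbb R$. Then $\Gamma(\mathcal L)$ is connected if and only if $\mathcal L$ is isomorphic to one of the following Lie algebras: $\mathfrak n_{2,1}\oplus\mathfrak n_{2,1}$ and $\mathfrak s_{4,11}$. Moreover, $\mathrm{diam}(\Gamma(\mathfrak n_{2,1}\oplus\mathfrak n_{2,1}))=\mathrm{diam}(\Gamma(\mathfrak s_{4,11}))=3$.
   Context: For a noncommutative (i.e. nonabelian) Lie algebra $\mathcal L$ with center $Z(\mathcal L)$, the commuting graph $\Gamma(\mathcal L)$ is the simple undirected graph with vertex set $V_{\mathcal L}=\mathcal L\setminus Z(\mathcal L)$, in which two distinct vertices $x,y$ are adjacent if and only if $[x,y]=0$. A graph is connected if every pair of distinct vertices is joined by a path, and the diameter of a connected graph is the supremum of the distances (lengths of shortest paths) between distinct vertices. $\mathfrak n_{2,1}$ is the real Lie algebra with basis $e_1,e_2$ and $[e_1,e_2]=e_1$. $\mathfrak s_{4,11}$ is the real Lie algebra with basis $e_1,e_2,e_3,e_4$ and non-trivial brackets $[e_2,e_3]=e_1$, $[e_4,e_1]=e_1$, $[e_4,e_2]=e_2$ (the remaining brackets $[e_1,e_2]$, $[e_1,e_3]$, $[e_4,e_3]$ of basis vectors being zero). $\oplus$ is the direct sum of Lie algebras. *)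

(* Defs.v *)
From HB Require Import structures.
From mathcomp Require Import all_boot all_order all_algebra.
From mathcomp Require Import ring.
From mathcomp Require Import all_classical all_reals ereal.

Set Implicit Arguments.
Unset Strict Implicit.
Unset Printing Implicit Defensive.

Import GRing.Theory Num.Theory.
Local Open Scope ring_scope.

HB.mixin Record Lmodule_isLieAlgebra (R : fieldType) V of GRing.Lmodule R V := {
  lie : V -> V -> V;
  lieDZl : forall (a : R) (x y z : V),
    lie (a *: x + y) z = a *: lie x z + lie y z;
  lieDZr : forall (a : R) (x y z : V),
    lie x (a *: y + z) = a *: lie x y + lie x z;
  liexx : forall x : V, lie x x = 0;
  lie_jacobi : forall x y z : V,
    lie x (lie y z) + lie y (lie z x) + lie z (lie x y) = 0
}.

#[short(type="lieAlgType")]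
HB.structure Definition LieAlgebra (R : fieldType) :=
  {V of GRing.Lmodule R V & Lmodule_isLieAlgebra R V}.

#[short(type="vectLieAlgType")]
HB.structure Definition VectLieAlgebra (R : fieldType) :=
  {V of Vector R V & Lmodule_isLieAlgebra R V}.

Definition lie_abelian (R : fieldType) (L : lieAlgType R) : Prop :=
  forall x y : L, lie x y = 0.

Definition lie_center (R : fieldType) (L : lieAlgType R) : set L :=
  [set x | forall y : L, lie x y = 0]%classic.
Arguments lie_center {R} L.

Definition lie_isomorphic (R : fieldType) (L1 L2 : lieAlgType R) : Prop :=
  exists f : {linear L1 -> L2}, bijective f /\ {morph f : x y / lie x y}.

(* The span of all brackets [u, v] with u in U and v in V; bases suffice by   *)
(* bilinearity, see liev_sub below.                                           *)
Definition liev (R : fieldType) (L : vectLieAlgType R) (U V : {vspace L}) :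
    {vspace L} :=
  <<[seq lie u v | u <- vbasis U, v <- vbasis V]>>%VS.

Definition lie_derived (R : fieldType) (L : vectLieAlgType R) (n : nat) :
    {vspace L} :=
  iter n (fun U => liev U U) fullv.

Definition lie_solvable (R : fieldType) (L : vectLieAlgType R) : Prop :=
  exists n : nat, lie_derived L n = 0%VS.

Section LieTheory.
Variables (R : fieldType) (L : lieAlgType R).
Implicit Types x y z : L.

Lemma lie0l y : lie 0 y = 0 :> L.
Proof. by have := lieDZl (- 1) y y y; rewrite !scaleN1r !addNr. Qed.

Lemma lie0r y : lie y 0 = 0 :> L.
Proof. by have := lieDZr (- 1) y y y; rewrite !scaleN1r !addNr. Qed.

Lemma lieDl x y z : lie (x + y) z = lie x z + lie y z.
Proof. by have := lieDZl 1 x y z; rewrite !scale1r. Qed.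

Lemma lieDr x y z : lie x (y + z) = lie x y + lie x z.
Proof. by have := lieDZr 1 x y z; rewrite !scale1r. Qed.

Lemma lieZl a x y : lie (a *: x) y = a *: lie x y.
Proof. by have := lieDZl a x 0 y; rewrite lie0l !addr0. Qed.

Lemma lieZr a x y : lie x (a *: y) = a *: lie x y.
Proof. by have := lieDZr a x y 0; rewrite lie0r !addr0. Qed.

Lemma lie_antisym x y : lie x y = - lie y x.
Proof.
apply/eqP; rewrite -addr_eq0; have := liexx (x + y).
by rewrite lieDl !lieDr !liexx add0r addr0 => ->.
Qed.

End LieTheory.

Lemma liev_sub (R : fieldType) (L : vectLieAlgType R) (U V W : {vspace L}) :
  (forall u v, u \in U -> v \in V -> lie u v \in W) <-> (liev U V <= W)%VS.
Proof.
split=> [UVW|/subvP sW u v uU vV].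
  by apply/span_subvP => _ /allpairsP[[u v] /= [/vbasis_mem uU /vbasis_mem vV ->]];
     exact: UVW.
apply: sW.
rewrite (coord_vbasis uU); elim/big_rec: _ => [|i w _ wUV].
  by rewrite lie0l mem0v.
rewrite lieDl lieZl; apply: rpredD => //; apply: rpredZ.
rewrite (coord_vbasis vV); elim/big_rec: _ => [|j t _ tUV].
  by rewrite lie0r mem0v.
rewrite lieDr lieZr; apply: rpredD => //; apply: rpredZ.
by apply/memv_span/allpairs_f; apply: mem_nth; rewrite size_tuple.
Qed.

(* The direct sum of Lie algebras is carried by the product type.             *)
Section DirectSum.
Variables (R : fieldType) (L1 L2 : lieAlgType R).
Implicit Types x y z : (L1 * L2)%type.

Definition pair_lie x y : (L1 * L2)%type := (lie x.1 y.1, lie x.2 y.2).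

Lemma pair_lieDZl a x y z :
  pair_lie (a *: x + y) z = a *: pair_lie x z + pair_lie y z.
Proof. by congr pair; rewrite /= lieDZl. Qed.

Lemma pair_lieDZr a x y z :
  pair_lie x (a *: y + z) = a *: pair_lie x y + pair_lie x z.
Proof. by congr pair; rewrite /= lieDZr. Qed.

Lemma pair_liexx x : pair_lie x x = 0.
Proof. by congr pair; rewrite /= liexx. Qed.

Lemma pair_lie_jacobi x y z :
  pair_lie x (pair_lie y z) + pair_lie y (pair_lie z x)
  + pair_lie z (pair_lie x y) = 0.
Proof. by congr pair; rewrite /= lie_jacobi. Qed.

HB.instance Definition _ := Lmodule_isLieAlgebra.Build R (L1 * L2)%type
  pair_lieDZl pair_lieDZr pair_liexx pair_lie_jacobi.

End DirectSum.

HB.instance Definition _ (R : fieldType) (L1 L2 : vectLieAlgType R) :=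
  LieAlgebra.on (L1 * L2)%type.

(* 1-based basis vectors and coordinates, meaningful for 1 <= k <= n.+1.      *)
Definition row_basis (R : fieldType) (n k : nat) : 'rV[R]_n.+1 :=
  delta_mx 0 (inord k.-1).

Definition row_coord (R : fieldType) (n : nat) (x : 'rV[R]_n.+1) (k : nat) : R :=
  x 0 (inord k.-1).

(* The bilinear alternating extension of [e_1, e_2] = e_1.                    *)
Definition n21 (R : fieldType) : Type := 'rV[R]_2.

Section N21.
Variable R : fieldType.

HB.instance Definition _ := Vector.on (n21 R).

Local Notation e := (row_basis R 1).

Definition n21_lie (x y : n21 R) : n21 R :=
  let x_ := row_coord x in let y_ := row_coord y in
  (x_ 1%N * y_ 2%N - x_ 2%N * y_ 1%N) *: e 1%N.

Lemma n21_lieDZl a x y z :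
  n21_lie (a *: x + y) z = a *: n21_lie x z + n21_lie y z.
Proof. by apply/rowP => k; rewrite /n21_lie /row_coord !mxE; ring. Qed.

Lemma n21_lieDZr a x y z :
  n21_lie x (a *: y + z) = a *: n21_lie x y + n21_lie x z.
Proof. by apply/rowP => k; rewrite /n21_lie /row_coord !mxE; ring. Qed.

Lemma n21_liexx x : n21_lie x x = 0.
Proof. by apply/rowP => k; rewrite /n21_lie /row_coord !mxE; ring. Qed.

Lemma n21_lie_jacobi x y z :
  n21_lie x (n21_lie y z) + n21_lie y (n21_lie z x)
  + n21_lie z (n21_lie x y) = 0.
Proof.
apply/rowP => k.
by rewrite /n21_lie /row_coord !mxE -!val_eqE /= !inordK //=; ring.
Qed.

HB.instance Definition _ := Lmodule_isLieAlgebra.Build R (n21 R)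
  n21_lieDZl n21_lieDZr n21_liexx n21_lie_jacobi.

Lemma n21_lieE : lie (e 1%N : n21 R) (e 2%N) = e 1%N.
Proof.
apply/rowP => k; rewrite -[lie _ _]/(n21_lie _ _) /n21_lie /row_coord !mxE -!val_eqE /=.
by rewrite !inordK //=; ring.
Qed.

End N21.

(* The bilinear alternating extension of [e_2, e_3] = e_1, [e_4, e_1] = e_1,  *)
(* [e_4, e_2] = e_2.                                                          *)
Definition s411 (R : fieldType) : Type := 'rV[R]_4.

Section S411.
Variable R : fieldType.

HB.instance Definition _ := Vector.on (s411 R).

Local Notation e := (row_basis R 3).

Definition s411_lie (x y : s411 R) : s411 R :=
  let x_ := row_coord x in let y_ := row_coord y in
  (x_ 2%N * y_ 3%N - x_ 3%N * y_ 2%N + (x_ 4%N * y_ 1%N - x_ 1%N * y_ 4%N))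
    *: e 1%N
  + (x_ 4%N * y_ 2%N - x_ 2%N * y_ 4%N) *: e 2%N.

Lemma s411_lieDZl a x y z :
  s411_lie (a *: x + y) z = a *: s411_lie x z + s411_lie y z.
Proof. by apply/rowP => k; rewrite /s411_lie /row_coord !mxE; ring. Qed.

Lemma s411_lieDZr a x y z :
  s411_lie x (a *: y + z) = a *: s411_lie x y + s411_lie x z.
Proof. by apply/rowP => k; rewrite /s411_lie /row_coord !mxE; ring. Qed.

Lemma s411_liexx x : s411_lie x x = 0.
Proof. by apply/rowP => k; rewrite /s411_lie /row_coord !mxE; ring. Qed.

Lemma s411_lie_jacobi x y z :
  s411_lie x (s411_lie y z) + s411_lie y (s411_lie z x)
  + s411_lie z (s411_lie x y) = 0.
Proof.
apply/rowP => k.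
by rewrite /s411_lie /row_coord !mxE -!val_eqE /= !inordK //=; ring.
Qed.

HB.instance Definition _ := Lmodule_isLieAlgebra.Build R (s411 R)
  s411_lieDZl s411_lieDZr s411_liexx s411_lie_jacobi.

Lemma s411_lieE :
  [/\ lie (e 2%N : s411 R) (e 3%N) = e 1%N,
      lie (e 4%N : s411 R) (e 1%N) = e 1%N &
      lie (e 4%N : s411 R) (e 2%N) = e 2%N]
  /\ [/\ lie (e 1%N : s411 R) (e 2%N) = 0,
      lie (e 1%N : s411 R) (e 3%N) = 0 &
      lie (e 4%N : s411 R) (e 3%N) = 0].
Proof.
by split; split; apply/rowP => k;
  rewrite -[lie _ _]/(s411_lie _ _) /s411_lie /row_coord !mxE -!val_eqE /= !inordK //=; ring.
Qed.

End S411.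

(* Simple undirected graphs, possibly infinite.                               *)
Record sgraph := SGraph {
  vertex :> eqType;
  adj : rel vertex;
  adj_sym : symmetric adj;
  adj_irr : irreflexive adj
}.

(* p lists the vertices after x, so size p is the length of the path.         *)
Definition gpath (G : sgraph) (x y : G) : set (seq G) :=
  [set p | [/\ path (@adj G) x p, last x p = y & uniq (x :: p)]]%classic.

Definition gconnected (G : sgraph) : Prop :=
  forall x y : G, x != y -> exists p, gpath x y p.

(* +oo when no path joins x and y.                                            *)
Definition gdist (R : realType) (G : sgraph) (x y : G) : \bar R :=
  ereal_inf [set ((size p)%:R%:E : \bar R) | p in gpath x y]%classic.

Definition gdiam (R : realType) (G : sgraph) : \bar R :=
  ereal_sup [set gdist R xy.1 xy.2 | xy in [set xy : G * G | xy.1 != xy.2]]%classic.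

Section CommutingGraph.
Variables (R : fieldType) (L : lieAlgType R).

Definition noncentral : eqType := {x : L | x \notin lie_center L}.

Definition commuting : rel noncentral :=
  fun x y => (x != y) && (lie (val x) (val y) == 0).

Lemma commuting_sym : symmetric commuting.
Proof. by move=> x y; rewrite /commuting eq_sym lie_antisym oppr_eq0. Qed.

Lemma commuting_irr : irreflexive commuting.
Proof. by move=> x; rewrite /commuting eqxx. Qed.

Definition commuting_graph : sgraph := SGraph commuting_sym commuting_irr.

End CommutingGraph.

(* Main.v *)
Require Import Defs.
From HB Require Import structures.
From mathcomp Require Import all_boot all_order all_algebra.
From mathcomp Require Import all_classical all_reals ereal.

(** Write C(x) for the centralizer of x.

    If the commuting graph is connected, the centralizer cannot stay constant
    along the noncentral elements commuting with a given x, for otherwise it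
    would be constant on the whole graph ([connected_centralizer_neq]).  So
    C(x) is never the span of x and the center.  In dimension 4 this has two
    consequences.
    - The center is zero ([connected_centerless]).  A central z <> 0 would make
      every C(x) abelian of dimension 3; two of them meet in a plane, whose
      elements commute with everything, and this puts into the center more than
      the line of z, which leaves no room for C(x).
    - Some ad y has rank one ([connected_rank1]).  If C(x) has dimension 2 it is
      abelian, so it is strictly contained in C(y) for a suitable y in C(x).

    Let then ad x have image the line of w, in a centerless algebra of dimension
    4 where every nonzero element commutes with an element outside its line.
    - If [x, w] <> 0, rescale x to get [x, w] = w.  The algebra is the direct sum
      of the span of x and w and of its centralizer, of dimension 2 and
      nonabelian because there is no center: this is n21 + n21
      ([n21sq_of_rank1]).
    - If [x, w] = 0, then w spans an ideal ([ideal_line_of_rank1_nilpotent]).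
      Choosing d acting on w as the identity, r commuting with w and d, and q
      completing a basis and commuting with w, the bracket [r, q] is a
      combination of w and r after the previous case is set aside, and a short
      computation leaves n21 + n21 or s411 ([frame_of_ideal_line]).

    Both algebras are recognized by frames: four elements with prescribed
    brackets and some nonzero entries.  In dimension 4 a frame is a basis,
    because its brackets let every coordinate be read off, so two algebras with
    frames of the same kind are isomorphic.

    Conversely a frame provides, between any two noncentral elements, a walk of
    three steps, and a noncommuting pair without common nonzero commuting
    element; hence the graph is connected with diameter exactly 3. *)

Set Implicit Arguments.
Unset Strict Implicit.
Unset Printing Implicit Defensive.

Import Order.TTheory GRing.Theory Num.Theory.
Local Open Scope ring_scope.

(** * Brackets *)

Section Brackets.
Variables (R : fieldType) (L : lieAlgType R).
Implicit Types x y z : L.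

Lemma lieNl x y : lie (- x) y = - lie x y.
Proof. by rewrite -scaleN1r lieZl scaleN1r. Qed.

Lemma lieNr x y : lie x (- y) = - lie x y.
Proof. by rewrite -scaleN1r lieZr scaleN1r. Qed.

Definition lieE := (lieDl, lieDr, lieZl, lieZr, lieNl, lieNr, lie0l, lie0r, @liexx).

Lemma lie_eq0C x y : lie x y = 0 -> lie y x = 0.
Proof. by rewrite lie_antisym => /eqP; rewrite oppr_eq0 => /eqP. Qed.

Lemma lie_leibniz x y z : lie x (lie y z) = lie (lie x y) z + lie y (lie x z).
Proof.
have /eqP := lie_jacobi x y z.
rewrite -addrA addr_eq0 => /eqP ->; rewrite opprD addrC.
by rewrite [lie (lie _ _) _]lie_antisym [lie z x]lie_antisym lieNr opprK.
Qed.

Lemma lie_suml n (F : 'I_n -> L) y :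
  lie (\sum_i F i) y = \sum_i lie (F i) y.
Proof. by apply: (big_morph (lie^~ y)) => [u v|]; rewrite ?lieDl ?lie0l. Qed.

HB.instance Definition _ x :=
  GRing.isLinear.Build R L L *:%R (lie x) (fun a => @lieDZr R L a x).

Lemma noncentralP x : reflect (exists y, lie x y != 0) (x \notin lie_center L).
Proof.
apply: (iffP idP) => [/negP xZ|[y xy0]].
  apply: contrapT => nxy; apply: xZ; rewrite inE => y.
  by apply/eqP; apply: contrapT => xy; apply: nxy; exists y; apply/negP.
by apply/negP; rewrite inE => /(_ y)/eqP; apply/negP.
Qed.

End Brackets.

(** * Linear algebra *)

Section LinearAlgebra.
Variables (R : fieldType) (V : vectType R).
Implicit Types (v : V) (U : {vspace V}).

Lemma dim_addv_line U v : v \notin U -> (\dim U < \dim (U + <[v]>))%N.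
Proof.
move=> vU; rewrite (ltn_leqif (dimv_leqif_sup (addvSl U <[v]>))).
by apply: contra vU => /subvP; apply; apply: subvP (addvSr U <[v]>) _ (memv_line v).
Qed.

Lemma addv_lineP U v w :
  reflect (exists2 u, u \in U & exists k, w = u + k *: v) (w \in (U + <[v]>)%VS).
Proof.
apply: (iffP memv_addP) => [[u uU [_ /vlineP[k ->] ->]]|[u uU [k ->]]].
  by exists u => //; exists k.
by exists u => //; exists (k *: v) => //; apply/vlineP; exists k.
Qed.

Lemma exists_notin U : (\dim U < \dim {: V})%N -> exists v, v \notin U.
Proof.
rewrite ltnNge => UV; apply: contrapT => h; move/negP: UV; apply; apply: dimvS.
by apply/subvP => v _; apply: contrapT => /negP vU; apply: h; exists v.
Qed.

Lemma free4 (a b c d : V) :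
  (forall k1 k2 k3 k4, k1 *: a + k2 *: b + k3 *: c + k4 *: d = 0 ->
     [/\ k1 = 0, k2 = 0, k3 = 0 & k4 = 0]) ->
  free [:: a; b; c; d].
Proof.
move=> h; apply/(@freeP _ _ _ [tuple a; b; c; d]) => k.
rewrite !big_ord_recl big_ord0 /= addr0 !addrA => /h[k1 k2 k3 k4] i.
by case: i => [[|[|[|[|//]]]] hi]; [rewrite -k1|rewrite -k2|rewrite -k3|rewrite -k4];
  congr (k _); apply: val_inj.
Qed.

Lemma free4_span (a b c d v : V) :
  \dim {: V} = 4%N -> free [:: a; b; c; d] ->
  exists k1 k2 k3 k4, v = k1 *: a + k2 *: b + k3 *: c + k4 *: d.
Proof.
move=> dimV fr; have bas : basis_of fullv [tuple a; b; c; d].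
  by rewrite basisEfree fr subvf dimV.
rewrite (coord_basis bas (memvf v)) !big_ord_recl big_ord0 /= addr0 !addrA.
by do 4 eexists.
Qed.

Lemma addv4_span (a b c d : V) :
  \dim {: V} = 4%N -> a != 0 -> b \notin <[a]>%VS ->
  c \notin (<[a]> + <[b]>)%VS -> d \notin (<[a]> + <[b]> + <[c]>)%VS ->
  (<[a]> + <[b]> + <[c]> + <[d]>)%VS = fullv.
Proof.
move=> dimV a0 ba cab dabc; apply/eqP; rewrite eqEdim subvf dimV /=.
have l1 := dim_addv_line ba; have l2 := dim_addv_line cab.
have l3 := dim_addv_line dabc; rewrite dim_vline a0 in l1.
exact: leq_ltn_trans (leq_ltn_trans l1 l2) l3.
Qed.

End LinearAlgebra.

Section BasisChange.
Variables (R : fieldType) (V W : vectType R) (n : nat).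
Implicit Types (b : n.-tuple V) (c : n.-tuple W).

(** The change of basis is written with coordinates, so that it is linear for
    arbitrary families and inverse to the map with the roles exchanged. *)
Definition basis_map (b : n.-tuple V) (c : n.-tuple W) (v : V) : W :=
  \sum_i coord b i v *: c`_i.

Lemma basis_map_linear b c : linear (basis_map b c).
Proof.
move=> a u v; rewrite /basis_map scaler_sumr -big_split.
by apply: eq_bigr => i _; rewrite linearP scalerDl scalerA.
Qed.

HB.instance Definition _ b c :=
  GRing.isLinear.Build R V W *:%R (basis_map b c) (basis_map_linear b c).

Lemma basis_mapE b c (i : 'I_n) : free b -> basis_map b c b`_i = c`_i.
Proof.
move=> fb; rewrite /basis_map (bigD1 i) //= coord_free // eqxx scale1r.
by rewrite big1 ?addr0 // => j ji; rewrite coord_free // eq_sym (negbTE ji) scale0r.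
Qed.

End BasisChange.

Lemma basis_mapK (R : fieldType) (V W : vectType R) n (b : n.-tuple V)
    (c : n.-tuple W) :
  basis_of fullv b -> free c -> cancel (basis_map b c) (basis_map c b).
Proof.
move=> bb fc v; rewrite [basis_map b c v]/basis_map linear_sum.
rewrite [RHS](coord_basis bb (memvf v)); apply: eq_bigr => i _.
by rewrite linearZ /= basis_mapE.
Qed.

(** Two algebras with the same structure constants are isomorphic; by
    antisymmetry it suffices to compare the brackets with i < j. *)
Lemma lie_isomorphic_bases (R : fieldType) (L1 L2 : vectLieAlgType R) n
    (b : n.-tuple L1) (c : n.-tuple L2) :
  basis_of fullv b -> basis_of fullv c ->
  (forall f : {linear L1 -> L2}, (forall i : 'I_n, f b`_i = c`_i) ->
     forall i j : 'I_n, (i < j)%N -> f (lie b`_i b`_j) = lie c`_i c`_j) ->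
  lie_isomorphic L1 L2.
Proof.
move=> bb bc bracket.
have fE (i : 'I_n) : basis_map b c b`_i = c`_i := basis_mapE c i (basis_free bb).
exists (basis_map b c : {linear L1 -> L2}); split.
  exists (basis_map c b); first exact: basis_mapK bb (basis_free bc).
  exact: basis_mapK bc (basis_free bb).
have lt_br := bracket (basis_map b c : {linear L1 -> L2}) fE.
have br (i j : 'I_n) : basis_map b c (lie b`_i b`_j) = lie c`_i c`_j.
  case: (ltngtP i j) => [|ji|/val_inj ->]; first exact: lt_br.
    by rewrite lie_antisym linearN /= lt_br // -lie_antisym.
  by rewrite !liexx linear0.
move=> x y /=; rewrite {1}(coord_basis bb (memvf x)) lie_suml linear_sum /=.
rewrite [basis_map b c x]/basis_map lie_suml; apply: eq_bigr => i _.
rewrite !lieZl linearZ /=; congr (_ *: _).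
rewrite {1}(coord_basis bb (memvf y)) linear_sum linear_sum /=.
rewrite [basis_map b c y]/basis_map linear_sum; apply: eq_bigr => j _.
by rewrite !linearZ /= br.
Qed.

(** * Frames *)

Lemma scaler_eq0P (R : fieldType) (V : lmodType R) k (v : V) :
  v != 0 -> k *: v = 0 -> k = 0.
Proof. by move=> v0 /eqP; rewrite scaler_eq0 (negbTE v0) orbF => /eqP. Qed.

Section Frames.
Variables (R : fieldType) (L : lieAlgType R).
Implicit Types (a b c d e : L) (k : R).

(** The brackets of n21 + n21, with (a, b) and (c, d) standing for the bases of
    the two summands.  Demanding a and c to be nonzero amounts to demanding that
    the four elements be free ([n21sq_frame_faithful]), and is easier to check. *)
Definition n21sq_frame (a b c d : L) : Prop :=
  [/\ a != 0, c != 0,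
      [/\ lie a b = a, lie c d = c & lie a c = 0] &
      [/\ lie a d = 0, lie b c = 0 & lie b d = 0]].

Definition s411_frame (e1 e2 e3 e4 : L) : Prop :=
  [/\ e1 != 0,
      [/\ lie e2 e3 = e1, lie e4 e1 = e1 & lie e4 e2 = e2] &
      [/\ lie e1 e2 = 0, lie e1 e3 = 0 & lie e4 e3 = 0]].

(** Bracketing with the frame itself isolates each of the four coordinates. *)
Lemma n21sq_frame_brackets a b c d k1 k2 k3 k4 :
  n21sq_frame a b c d ->
  let v := k1 *: a + k2 *: b + k3 *: c + k4 *: d in
  [/\ lie v b = k1 *: a, lie a v = k2 *: a, lie v d = k3 *: c &
      lie c v = k4 *: c].
Proof.
case=> _ _ [ab cd ac] [ad bc bd] /=; rewrite !lieE ab cd ac ad bd.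
rewrite (lie_eq0C ac) (lie_eq0C bc) (lie_eq0C bd).
by rewrite !scaler0 !addr0 !add0r.
Qed.

(** This yields at once the freeness of a frame, taking a vanishing
    combination, and the absence of center. *)
Lemma n21sq_frame_faithful a b c d k1 k2 k3 k4 :
  n21sq_frame a b c d ->
  (forall u, lie (k1 *: a + k2 *: b + k3 *: c + k4 *: d) u = 0) ->
  [/\ k1 = 0, k2 = 0, k3 = 0 & k4 = 0].
Proof.
move=> F v0; have [vb av vd cv] := n21sq_frame_brackets k1 k2 k3 k4 F.
have [a0 c0 _ _] := F.
split.
- by apply: (scaler_eq0P a0); rewrite -vb v0.
- by apply: (scaler_eq0P a0); rewrite -av; apply: lie_eq0C.
- by apply: (scaler_eq0P c0); rewrite -vd v0.
- by apply: (scaler_eq0P c0); rewrite -cv; apply: lie_eq0C.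
Qed.

Lemma s411_frame_brackets e1 e2 e3 e4 k1 k2 k3 k4 :
  s411_frame e1 e2 e3 e4 ->
  let v := k1 *: e1 + k2 *: e2 + k3 *: e3 + k4 *: e4 in
  [/\ lie e4 v = k1 *: e1 + k2 *: e2, lie v e3 = k2 *: e1,
      lie e2 v = k3 *: e1 - k4 *: e2 & lie v e1 = k4 *: e1].
Proof.
case=> _ [e23 e41 e42] [e12 e13 e43] /=; rewrite !lieE e41 e42 e43 e13 e23.
rewrite (lie_eq0C e12) (lie_eq0C e13) [lie e2 e4]lie_antisym e42.
by rewrite !scaler0 !addr0 !add0r scalerN.
Qed.

(** The coordinates k4 and k2 come out first; k3 and k1 are only isolated once
    these are known to vanish. *)
Lemma s411_frame_faithful e1 e2 e3 e4 k1 k2 k3 k4 :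
  s411_frame e1 e2 e3 e4 ->
  (forall u, lie (k1 *: e1 + k2 *: e2 + k3 *: e3 + k4 *: e4) u = 0) ->
  [/\ k1 = 0, k2 = 0, k3 = 0 & k4 = 0].
Proof.
move=> F v0; have [e4v ve3 e2v ve1] := s411_frame_brackets k1 k2 k3 k4 F.
have [e10 _ _] := F.
have k4_0 : k4 = 0 by apply: (scaler_eq0P e10); rewrite -ve1 v0.
have k2_0 : k2 = 0 by apply: (scaler_eq0P e10); rewrite -ve3 v0.
split=> //; apply: (scaler_eq0P e10).
  by move: (lie_eq0C (v0 e4)); rewrite e4v k2_0 scale0r addr0.
by move: (lie_eq0C (v0 e2)); rewrite e2v k4_0 scale0r subr0.
Qed.

End Frames.

Section FrameBasis.
Variables (R : fieldType) (L : vectLieAlgType R).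
Hypothesis dimL : \dim {: L} = 4%N.

Lemma n21sq_frame_basis (a b c d : L) :
  n21sq_frame a b c d -> basis_of fullv [:: a; b; c; d].
Proof.
move=> F; rewrite basisEfree dimL subvf !andbT.
apply: free4 => k1 k2 k3 k4 E; apply: (n21sq_frame_faithful F) => u.
by rewrite E lie0l.
Qed.

Lemma s411_frame_basis (e1 e2 e3 e4 : L) :
  s411_frame e1 e2 e3 e4 -> basis_of fullv [:: e1; e2; e3; e4].
Proof.
move=> F; rewrite basisEfree dimL subvf !andbT.
apply: free4 => k1 k2 k3 k4 E; apply: (s411_frame_faithful F) => u.
by rewrite E lie0l.
Qed.

End FrameBasis.

Section FrameIsomorphism.
Variables (R : fieldType) (L1 L2 : vectLieAlgType R).
Hypotheses (dim1 : \dim {: L1} = 4%N) (dim2 : \dim {: L2} = 4%N).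

Lemma n21sq_frame_isomorphic (a b c d : L1) (a' b' c' d' : L2) :
  n21sq_frame a b c d -> n21sq_frame a' b' c' d' -> lie_isomorphic L1 L2.
Proof.
move=> F F'; apply: (@lie_isomorphic_bases _ _ _ _ [tuple a; b; c; d]
  [tuple a'; b'; c'; d'] (n21sq_frame_basis dim1 F) (n21sq_frame_basis dim2 F')).
move=> f fE; case: F F' => _ _ [ab cd ac] [ad bc bd] [_ _ [ab' cd' ac'] [ad' bc' bd']].
have [/= fa fc] := (fE 0, fE (inord 2)); rewrite inordK //= in fc.
case=> [[|[|[|[|//]]]] ?] [[|[|[|[|//]]]] ?] //= _;
  by rewrite ?(ab, cd, ac, ad, bc, bd, ab', cd', ac', ad', bc', bd') ?linear0.
Qed.

Lemma s411_frame_isomorphic (e1 e2 e3 e4 : L1) (e1' e2' e3' e4' : L2) :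
  s411_frame e1 e2 e3 e4 -> s411_frame e1' e2' e3' e4' -> lie_isomorphic L1 L2.
Proof.
move=> F F'; apply: (@lie_isomorphic_bases _ _ _ _ [tuple e1; e2; e3; e4]
  [tuple e1'; e2'; e3'; e4'] (s411_frame_basis dim1 F) (s411_frame_basis dim2 F')).
move=> f fE; have [_ [e23 e41 e42] [e12 e13 e43]] := F.
have [_ [e23' e41' e42'] [e12' e13' e43']] := F'.
have [/= f1 f2] := (fE 0, fE 1); rewrite /= in f2.
have [[e14 e24] e34] := (lie_antisym e1 e4, lie_antisym e2 e4, lie_eq0C e43).
have [[e14' e24'] e34'] := (lie_antisym e1' e4', lie_antisym e2' e4', lie_eq0C e43').
rewrite e41 e42 e41' e42' in e14 e24 e14' e24'.
case=> [[|[|[|[|//]]]] ?] [[|[|[|[|//]]]] ?] //= _;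
  by rewrite ?(e23, e12, e13, e14, e24, e34, e23', e12', e13', e14', e24', e34')
    ?linearN ?linear0 /= ?(f1, f2).
Qed.

End FrameIsomorphism.

Section Models.
Variable R : fieldType.

Lemma dim_n21sq : \dim {: (n21 R * n21 R)%type} = 4%N.
Proof. by rewrite dimvf. Qed.

Lemma dim_s411 : \dim {: s411 R} = 4%N.
Proof. by rewrite dimvf. Qed.

Local Notation e := (row_basis R 1).

Lemma row_basis_neq0 n k : row_basis R n k != 0.
Proof.
apply/eqP => /rowP/(_ (inord k.-1)); rewrite !mxE !eqxx => /eqP.
by rewrite oner_eq0.
Qed.

Lemma n21sq_model_frame :
  n21sq_frame ((e 1%N, 0) : (n21 R * n21 R)%type) (e 2%N, 0) (0, e 1%N) (0, e 2%N).
Proof.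
split; last 2 first.
- by split; congr pair; rewrite ?lie0l ?lie0r ?n21_lieE.
- by split; congr pair; rewrite ?lie0l ?lie0r ?n21_lieE.
- by apply/eqP => -[] /eqP; apply/negP/row_basis_neq0.
- by apply/eqP => -[] /eqP; apply/negP/row_basis_neq0.
Qed.

Lemma s411_model_frame :
  s411_frame (row_basis R 3 1 : s411 R) (row_basis R 3 2) (row_basis R 3 3)
    (row_basis R 3 4).
Proof.
have [[e23 e41 e42] [e12 e13 e43]] := s411_lieE R.
by split=> //; apply: row_basis_neq0.
Qed.

End Models.

(** * Centerless algebras of dimension 4 *)

Section Centralizer.
Variables (R : fieldType) (L : vectLieAlgType R).
Implicit Types x y : L.

Definition centralizer x : {vspace L} := lker (linfun (lie x)).

Lemma mem_centralizer x y : (y \in centralizer x) = (lie x y == 0).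
Proof. by rewrite memv_ker lfunE. Qed.

Lemma centralizer_line x y : (<[y]> <= centralizer x)%VS = (lie x y == 0).
Proof. by rewrite -memvE mem_centralizer. Qed.

Lemma centralizer_full x :
  (centralizer x == fullv) -> forall y, lie x y = 0.
Proof. by move=> /eqP E y; apply/eqP; rewrite -mem_centralizer E memvf. Qed.

End Centralizer.

Section CenterlessDimension4.
Variables (R : fieldType) (L : vectLieAlgType R).
Hypothesis dimL : \dim {: L} = 4%N.
Hypothesis center0 : forall z : L, (forall v, lie z v = 0) -> z = 0.
Implicit Types x y v w : L.

Lemma centralizer_eq_full x a b c d :
  (<[a]> + <[b]> + <[c]> + <[d]>)%VS = fullv ->
  lie x a = 0 -> lie x b = 0 -> lie x c = 0 -> lie x d = 0 -> x = 0.
Proof.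
move=> full xa xb xc xd; apply: center0; apply: centralizer_full.
by rewrite eqEsubv subvf -full !subv_add !centralizer_line xa xb xc xd eqxx.
Qed.

(** Since ad x is a projection onto the line of w, the algebra is the direct sum
    of the span of x and w and of K, the common centralizer of x and w.  If K
    were abelian it would be central, so K contains a bracket r <> 0; as K has
    dimension 2, some s in K satisfies [r, s] = r. *)
Lemma n21sq_of_rank1_idempotent x w :
  w != 0 -> (forall v, exists c, lie x v = c *: w) -> lie x w = w ->
  exists a b c d : L, n21sq_frame a b c d.
Proof.
move=> w0 rk xw.
(* C(x) acts on the line of w, which ad x fixes pointwise: subtracting the
   right multiple of x from an element of C(x) lands in K. *)
have decomp v : exists u m c,
    [/\ lie x u = 0, lie w u = 0 & v = u + m *: x + c *: w].
  have [c xv] := rk v; move Dk: (v - c *: w) => k.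
  have xk : lie x k = 0 by rewrite -Dk !lieE xv xw subrr.
  have [m xkw] := rk (lie k w).
  have kw : lie k w = m *: w by rewrite -xkw lie_leibniz xk xw lie0l add0r.
  exists (k - m *: x), m, c; split; last by rewrite subrK -Dk subrK.
    by rewrite !lieE xk scaler0 subrr.
  rewrite !lieE lie_antisym kw [lie w x]lie_antisym xw.
  by rewrite scalerN opprK addNr.
have [p [q [[xp wp] [xq wq] pq0]]] : exists p q,
    [/\ lie x p = 0 /\ lie w p = 0, lie x q = 0 /\ lie w q = 0 & lie p q != 0].
  apply: contrapT => abel.
  have [v vxw] : exists v, v \notin (<[x]> + <[w]>)%VS.
    apply: exists_notin; rewrite dimL.
    apply: leq_ltn_trans (dimv_add_leqif <[x]> <[w]>) _.
    by rewrite !dim_vline; case: (_ != _); case: (_ != _).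
  have [u [m [c [xu wu Ev]]]] := decomp v.
  case/negP: vxw; rewrite Ev; suff -> : u = 0.
    rewrite add0r; apply: memv_add; apply/vlineP; by eexists.
  apply: center0 => v'; have [u' [m' [c' [xu' wu' ->]]]] := decomp v'.
  rewrite !lieE (lie_eq0C xu) (lie_eq0C wu) !scaler0 !addr0.
  by apply/eqP; apply: contrapT => /negP uu'; apply: abel; exists u, u'.
move Dr: (lie p q) => r; rewrite Dr in pq0.
have xr : lie x r = 0 by rewrite -Dr lie_leibniz xp xq lie0l lie0r addr0.
have wr : lie w r = 0 by rewrite -Dr lie_leibniz wp wq lie0l lie0r addr0.
(* Bracketing with w, x, q and p isolates the four coordinates in turn. *)
have fr : free [:: x; w; p; q].
  apply: free4 => k1 k2 k3 k4 E; split.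
  - have := congr1 (lie^~ w) E; rewrite !lieE xw (lie_eq0C wp) (lie_eq0C wq).
    by rewrite !scaler0 !addr0 => /(scaler_eq0P w0).
  - have := congr1 (lie x) E; rewrite !lieE xw xp xq.
    by rewrite !scaler0 !addr0 add0r => /(scaler_eq0P w0).
  - have := congr1 (lie^~ q) E; rewrite !lieE xq wq Dr.
    by rewrite !scaler0 !addr0 !add0r => /(scaler_eq0P pq0).
  - have := congr1 (lie p) E; rewrite !lieE (lie_eq0C xp) (lie_eq0C wp) Dr.
    by rewrite !scaler0 !add0r => /(scaler_eq0P pq0).
have [k1 [k2 [k3 [k4 Er]]]] := free4_span r dimL fr.
have k1_0 : k1 = 0.
  have := lie_eq0C wr; rewrite Er !lieE xw (lie_eq0C wp) (lie_eq0C wq).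
  by rewrite !scaler0 !addr0 => /(scaler_eq0P w0).
have k2_0 : k2 = 0.
  have := xr; rewrite Er !lieE xw xp xq.
  by rewrite !scaler0 !addr0 add0r => /(scaler_eq0P w0).
rewrite k1_0 k2_0 !scale0r !add0r in Er.
have [s [rs xs ws]] : exists s, [/\ lie r s = r, lie x s = 0 & lie w s = 0].
  have [k3_0|k3_0] := eqVneq k3 0.
    have k4_0 : k4 != 0.
      by apply: contraNneq pq0 => k4_0; rewrite Er k3_0 k4_0 !scale0r addr0.
    exists (- k4^-1 *: p); split; rewrite ?lieZr ?xp ?wp ?scaler0 //.
    rewrite {1}Er k3_0 scale0r add0r lieZl [lie q p]lie_antisym Dr.
    by rewrite scalerN scaleNr scalerN opprK scalerA mulVf ?scale1r.
  exists (k3^-1 *: q); split; rewrite ?lieZr ?xq ?wq ?scaler0 //.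
  by rewrite {1}Er !lieE Dr scaler0 addr0 scalerA mulVf ?scale1r.
exists w, (- x), r, s; split=> //; split; rewrite ?lieNr ?lieNl //.
- by rewrite lie_antisym opprK.
- by rewrite xr oppr0.
- by rewrite xs oppr0.
Qed.

Lemma n21sq_of_rank1 x w :
  (forall v, exists c, lie x v = c *: w) -> lie x w != 0 ->
  exists a b c d : L, n21sq_frame a b c d.
Proof.
move=> rk xw0; have [l xw] := rk w.
have l0 : l != 0 by apply: contraNneq xw0 => l0; rewrite xw l0 scale0r.
have w0 : w != 0 by apply: contraNneq xw0 => w0; rewrite w0 lie0r.
apply: (@n21sq_of_rank1_idempotent (l^-1 *: x) w) => // [v|].
  by have [c xv] := rk v; exists (l^-1 * c); rewrite lieZl xv scalerA.
by rewrite lieZl xw scalerA mulVf ?scale1r.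
Qed.

Hypothesis not_isolated :
  forall d : L, d != 0 -> exists2 y, lie d y = 0 & y \notin <[d]>%VS.

(** Write w for [x, d].  For k in C(x), [k, w] = [x, [k, d]] lies in the image
    of ad x, which is the line of w.  It remains to see that d does too: as d is not isolated,
    some r <> 0 in C(x) commutes with d.  If w were outside the span of x and r,
    then r would commute with the basis x, r, w, d.  So w is a combination of x
    and r, and [d, w] is a multiple of [d, x]. *)
Lemma ideal_line_of_rank1_nilpotent x d :
  lie x d != 0 -> (forall v, exists c, lie x v = c *: lie x d) ->
  lie x (lie x d) = 0 ->
  forall v, exists c, lie v (lie x d) = c *: lie x d.
Proof.
set w := lie x d => w0 rk xw.
have d0 : d != 0 by apply: contraNneq w0 => d0; rewrite /w d0 lie0r.
have x0 : x != 0 by apply: contraNneq w0 => x0; rewrite /w x0 lie0l.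
have [y dy yd] := not_isolated d0; have [c xy] := rk y; move Dr: (y - c *: d) => r.
have xr : lie x r = 0 by rewrite -Dr !lieE xy -/w subrr.
have dr : lie d r = 0 by rewrite -Dr !lieE dy scaler0 subrr.
have r0 : r != 0.
  apply: contraNneq yd => /eqP; rewrite -Dr subr_eq0 => /eqP ->.
  by rewrite memvZ ?memv_line.
have wr : lie w r = 0.
  have := lie_leibniz x d r; rewrite dr xr !lie0r addr0; exact: esym.
have rx : r \notin <[x]>%VS.
  apply/vlineP => -[k Er]; have := dr; rewrite Er lieZr lie_antisym -/w scalerN.
  move=> /eqP; rewrite oppr_eq0 => /eqP/(scaler_eq0P w0) k0.
  by move: r0; rewrite Er k0 scale0r eqxx.
have wxr : w \in (<[x]> + <[r]>)%VS.
  apply: contraNT r0 => wxr; apply/eqP.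
  apply: (@centralizer_eq_full r x r w d).
  - apply: addv4_span => //; apply: contra w0; rewrite /w -mem_centralizer.
    apply: subvP.
    by rewrite !subv_add !centralizer_line liexx xr xw eqxx.
  - exact: lie_eq0C.
  - exact: liexx.
  - exact: lie_eq0C.
  - exact: lie_eq0C.
have [_ /vlineP[a ->] [b Ew]] := addv_lineP _ _ _ wxr.
move=> v; have [e xv] := rk v; move Dk: (v - e *: d) => k.
have kx : lie k x = 0 by apply: lie_eq0C; rewrite -Dk !lieE xv -/w subrr.
have [m xkd] := rk (lie k d).
have kw : lie k w = m *: w by rewrite /w lie_leibniz kx lie0l add0r xkd.
have dw : lie d w = - a *: w.
  by rewrite {1}Ew !lieE dr scaler0 addr0 lie_antisym -/w scalerN scaleNr.
exists (m - e * a); rewrite -[v](subrK (e *: d)) Dk !lieE kw dw.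
by rewrite scalerBl scalerA mulrN scaleNr.
Qed.

(** Choose d with [d, x] = x, then r commuting with x and d, and q commuting
    with x such that x, r, d, q is a basis; let s be [r, q], the only nonzero
    bracket of r with the basis.  If [r, s] <> 0, [n21sq_of_rank1] applies to r.
    Otherwise s = a x + b r, and since d commutes with r, ad d maps s to t s where
    t is the coordinate of [d, q] on q.  This forces a = t a and t b = 0: either
    b = 0 and t = 1, which gives s411, or t = a = 0, which gives n21 + n21. *)
Lemma frame_of_ideal_line x :
  x != 0 -> (forall v, exists c, lie v x = c *: x) ->
  (exists a b c d : L, n21sq_frame a b c d) \/
  (exists e1 e2 e3 e4 : L, s411_frame e1 e2 e3 e4).
Proof.
move=> x0 idx.
have [d dx] : exists d, lie d x = x.
  have [d0 dx0] : exists d, lie d x != 0.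
    apply: contrapT => nd; case/eqP: x0; apply: center0 => v.
    by apply: lie_eq0C; apply/eqP; apply: contrapT => /negP vx; apply: nd; exists v.
  have [c dx] := idx d0.
  have c0 : c != 0 by apply: contraNneq dx0 => c0; rewrite dx c0 scale0r.
  by exists (c^-1 *: d0); rewrite lieZl dx scalerA mulVf ?scale1r.
have d0 : d != 0 by apply: contraNneq x0 => d0; rewrite -dx d0 lie0l.
have [y dy yd] := not_isolated d0; have [c yx] := idx y; move Dr: (y - c *: d) => r.
have rx : lie r x = 0 by rewrite -Dr !lieE yx dx subrr.
have dr : lie d r = 0 by rewrite -Dr !lieE dy scaler0 subrr.
have r0 : r != 0.
  apply: contraNneq yd => /eqP; rewrite -Dr subr_eq0 => /eqP ->.
  by rewrite memvZ ?memv_line.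
have indep_xr a b : a *: x + b *: r = 0 -> a = 0 /\ b = 0.
  move=> E; have a0 : a = 0.
    by have := congr1 (lie d) E; rewrite !lieE dx dr scaler0 addr0 => /(scaler_eq0P x0).
  by move: E; rewrite a0 scale0r add0r => /(scaler_eq0P r0).
have [v vxrd] : exists v, v \notin (<[x]> + <[r]> + <[d]>)%VS.
  apply: exists_notin; rewrite dimL.
  apply: leq_ltn_trans (dimv_add_leqif _ <[d]>) _.
  rewrite dim_vline d0 addn1 ltnS; apply: leq_ltn_trans (dimv_add_leqif _ _) _.
  by rewrite !dim_vline x0 r0.
have [e vx] := idx v; move Dq: (v - e *: d) => q.
have qx : lie q x = 0 by rewrite -Dq !lieE vx dx subrr.
have qxrd : q \notin (<[x]> + <[r]> + <[d]>)%VS.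
  apply: contra vxrd => /addv_lineP[u uxr [k Eq]]; apply/addv_lineP.
  exists u => //; exists (k + e).
  by rewrite scalerDl addrA -Eq -Dq subrK.
have full : (<[x]> + <[r]> + <[d]> + <[q]>)%VS = fullv.
  apply: addv4_span => //.
  - apply/vlineP => -[k Er]; case: (indep_xr k (-1)).
      by rewrite scaleN1r Er subrr.
    by move=> _ /eqP; rewrite oppr_eq0 oner_eq0.
  - apply/addv_lineP => -[_ /vlineP[k ->] [l Ed]]; move: x0.
    by rewrite -dx Ed !lieE rx !scaler0 addr0 eqxx.
have span u : exists k1 k2 k3 k4, u = k1 *: x + k2 *: r + k3 *: d + k4 *: q.
  have := memvf u; rewrite -full => /addv_lineP[u3 /addv_lineP[u2]].
  move=> /addv_lineP[_ /vlineP[k1 ->] [k2 ->]] [k3 ->] [k4 ->].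
  by exists k1, k2, k3, k4.
move Ds: (lie r q) => s.
have s0 : s != 0.
  apply: contraNneq r0 => s0; apply/eqP.
  by apply: (centralizer_eq_full full); rewrite ?liexx ?Ds ?(lie_eq0C dr).
have [rs|rs] := eqVneq (lie r s) 0; last first.
  left; apply: (n21sq_of_rank1 _ rs) => u; have [k1 [k2 [k3 [k4 ->]]]] := span u.
  by exists k4; rewrite !lieE rx (lie_eq0C dr) !scaler0 !add0r Ds.
have sx : lie s x = 0.
  apply: lie_eq0C; rewrite -Ds lie_leibniz (lie_eq0C rx) (lie_eq0C qx).
  by rewrite lie0l lie0r addr0.
have [a [b Es]] : exists a b, s = a *: x + b *: r.
  have [k1 [k2 [k3 [k4 Es]]]] := span s; exists k1, k2.
  have k4_0 : k4 = 0.
    move: rs; rewrite {1}Es !lieE rx (lie_eq0C dr) !scaler0 !add0r Ds.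
    exact: scaler_eq0P.
  have k3_0 : k3 = 0.
    move: sx; rewrite {1}Es !lieE rx qx dx !scaler0 !add0r addr0.
    exact: scaler_eq0P.
  by rewrite {1}Es k3_0 k4_0 !scale0r !addr0.
have [t1 [t2 [t Edq]]] : exists t1 t2 t, lie d q = t1 *: x + t2 *: r + t *: q.
  have [k1 [k2 [k3 [k4 Et]]]] := span (lie d q); exists k1, k2, k4.
  suff k3_0 : k3 = 0 by rewrite Et k3_0 scale0r addr0.
  have : lie x (lie d q) = 0.
    rewrite lie_leibniz [lie x d]lie_antisym dx (lie_eq0C qx) lie0r addr0.
    by rewrite lieNl (lie_eq0C qx) oppr0.
  move=> /lie_eq0C; rewrite Et !lieE rx qx dx !scaler0 !add0r addr0.
  exact: scaler_eq0P.
(* Compare the coordinates on x and r of [d, s] = t s. *)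
have [ta tb] : a = t * a /\ t * b = 0.
  have : lie d s = t *: s.
    by rewrite -Ds lie_leibniz dr lie0l add0r Edq !lieE rx !scaler0 !add0r.
  rewrite Es !lieE dx dr scaler0 addr0 scalerDr !scalerA => E.
  case: (indep_xr (a - t * a) (- (t * b))).
    by rewrite scalerBl {1}E scaleNr addrAC addrK subrr.
  by move=> /eqP; rewrite subr_eq0 => /eqP <- /eqP; rewrite oppr_eq0 => /eqP.
have [b0|b0] := eqVneq b 0; [right|left].
  rewrite b0 scale0r addr0 in Es.
  have a0 : a != 0 by apply: contraNneq s0 => a0; rewrite Es a0 scale0r.
  have t1E : t = 1 by apply: (mulIf a0); rewrite -ta mul1r.
  (* The correction of q removes r from [d, q], that of d removes x. *)
  move Dq': (q + t2 *: r) => q'; move Dd': (d - (t1 / a) *: r) => d'.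
  have rq' : lie r q' = a *: x by rewrite -Dq' !lieE Ds Es scaler0 addr0.
  exists x, q', (- a^-1 *: r), d'; split=> //; split.
  - by rewrite lieZr lie_antisym rq' scaleNr scalerN opprK scalerA mulVf ?scale1r.
  - by rewrite -Dd' !lieE rx dx scaler0 subr0.
  - rewrite -{1}Dd' !lieE rq' scalerA divfK // -Dq' !lieE dr scaler0 addr0 Edq t1E.
    by rewrite scale1r addrAC [_ + _ - _]addrAC subrr add0r addrC.
  - by apply: lie_eq0C; rewrite -Dq' !lieE rx qx scaler0 addr0.
  - by rewrite lieZr (lie_eq0C rx) scaler0.
  - by rewrite lieZr -Dd' !lieE dr !scaler0 subr0 scaler0.
have t0 : t = 0 by apply: (mulIf b0); rewrite tb mul0r.
have a0 : a = 0 by rewrite ta t0 mul0r.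
rewrite a0 scale0r add0r in Es; rewrite t0 scale0r addr0 in Edq.
(* The correction of q removes x from [d, q], that of d removes r. *)
move Dq': (q - t1 *: x) => q'; move Dd': (d - (t2 / b) *: r) => d'.
have rq' : lie r q' = b *: r by rewrite -Dq' !lieE rx Ds Es scaler0 subr0.
have xq' : lie x q' = 0.
  by apply: lie_eq0C; rewrite -Dq' !lieE qx scaler0 subr0.
exists x, (- d'), r, (b^-1 *: q'); split=> //; split.
- by rewrite lieNr -lie_antisym -Dd' !lieE rx dx scaler0 subr0.
- by rewrite lieZr rq' scalerA mulVf ?scale1r.
- exact: lie_eq0C.
- by rewrite lieZr xq' scaler0.
- by rewrite lieNl -Dd' !lieE dr scaler0 subr0 oppr0.
- rewrite lieNl lieZr -{1}Dd' !lieE rq' scalerA divfK // -Dq' !lieE dx Edq.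
  by rewrite addrAC addrK subrr scaler0 oppr0.
Qed.

Lemma frame_of_rank1 x d :
  lie x d != 0 -> (forall v, exists c, lie x v = c *: lie x d) ->
  (exists a b c d : L, n21sq_frame a b c d) \/
  (exists e1 e2 e3 e4 : L, s411_frame e1 e2 e3 e4).
Proof.
move=> xd rk; have [xxd|xxd] := eqVneq (lie x (lie x d)) 0.
  exact: frame_of_ideal_line xd (ideal_line_of_rank1_nilpotent xd rk xxd).
by left; apply: n21sq_of_rank1 rk xxd.
Qed.

End CenterlessDimension4.

(** * Consequences of connectedness *)

(** Connectedness is used only in this form: a property stable under adjacency
    holds everywhere as soon as it holds somewhere. *)
Lemma gconnected_closed (G : sgraph) (P : G -> Prop) :
  gconnected G -> (forall x y, adj x y -> P x -> P y) ->
  forall x y, P x -> P y.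
Proof.
move=> con closedP x y Px; have [<-//|xy] := eqVneq x y.
have [p [+ <- _]] := con _ _ xy.
elim: p x Px {xy} => [|z p IHp] x Px //= /andP[/closedP xz].
by apply: IHp; apply: xz.
Qed.

Section ConnectedCommutingGraph.
Variables (R : fieldType) (L : vectLieAlgType R).
Hypothesis conL : gconnected (commuting_graph L).
Implicit Types x y z v : L.

(** Otherwise having the same centralizer as x would be stable under adjacency,
    hence shared by x', which commutes with itself but not with x. *)
Lemma connected_centralizer_neq x x' :
  lie x x' != 0 ->
  exists y, [/\ exists v, lie y v != 0, lie x y = 0 &
                centralizer y <> centralizer x].
Proof.
move=> xx'; apply: contrapT => same.
have xZ : x \notin lie_center L by apply/noncentralP; exists x'.
have x'Z : x' \notin lie_center L.
  by apply/noncentralP; exists x; rewrite lie_antisym oppr_eq0.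
pose P (v : commuting_graph L) := centralizer (val v) = centralizer x.
suff : P (exist _ x' x'Z).
  move=> /vspaceP/(_ x'); rewrite !mem_centralizer liexx eqxx => /esym.
  by apply/negP.
apply: (gconnected_closed conL) (exist _ x xZ) _ _ => // u v /andP[_ uv] Pu.
apply: contrapT => Pv; apply: same; exists (val v); split=> //.
  by apply/noncentralP; case: v {uv Pv}.
by apply/eqP; rewrite -mem_centralizer -[centralizer x]Pu mem_centralizer.
Qed.

(** A noncentral element of the span of x and the center has the same
    centralizer as x. *)
Lemma connected_not_isolated x x' :
  lie x x' != 0 ->
  exists2 y, lie x y = 0 &
    forall a z, (forall v, lie z v = 0) -> y <> a *: x + z.
Proof.
move=> xx'; have [y [[v yv] xy neq]] := connected_centralizer_neq xx'.
exists y => // a z zZ Ey; apply: neq; apply/vspaceP => u.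
rewrite !mem_centralizer Ey !lieE zZ addr0 scaler_eq0.
suff /negbTE-> : a != 0 by [].
by apply: contraNneq yv => a0; rewrite Ey !lieE zZ a0 scale0r addr0.
Qed.

Hypothesis dimL : \dim {: L} = 4%N.

Lemma dim_centralizer_le3 x x' : lie x x' != 0 -> (\dim (centralizer x) <= 3)%N.
Proof.
move=> xx'; rewrite -ltnS -dimL (ltn_leqif (dimv_leqif_sup (subvf _))).
by apply: contra xx' => /subvP/(_ x' (memvf _)); rewrite mem_centralizer.
Qed.

(** The elements z, x and y are independent in C(x), which is a proper
    subspace. *)
Lemma connected_centralizer_dim3 x x' z :
  lie x x' != 0 -> z != 0 -> (forall v, lie z v = 0) ->
  exists y, [/\ centralizer x = (<[z]> + <[x]> + <[y]>)%VS,
    \dim (centralizer x) = 3%N &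
    forall a t, (forall v, lie t v = 0) -> y <> a *: x + t].
Proof.
move=> xx' z0 zZ; have [y xy ynot] := connected_not_isolated xx'.
have xz : x \notin <[z]>%VS.
  by apply: contra xx' => /vlineP[k ->]; rewrite lieZl zZ scaler0.
have yzx : y \notin (<[z]> + <[x]>)%VS.
  apply/addv_lineP => -[_ /vlineP[k ->] [l Ey]]; apply: (ynot l (k *: z)).
    by move=> v; rewrite lieZl zZ scaler0.
  by rewrite Ey addrC.
have sub : (<[z]> + <[x]> + <[y]> <= centralizer x)%VS.
  by rewrite !subv_add !centralizer_line (lie_eq0C (zZ x)) liexx xy eqxx.
have dim3 : (3 <= \dim (<[z]> + <[x]> + <[y]>))%N.
  have := leq_ltn_trans (dim_addv_line xz) (dim_addv_line yzx).
  by rewrite dim_vline z0.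
exists y; split=> //.
  by apply/eqP; rewrite eq_sym eqEdim sub (leq_trans (dim_centralizer_le3 xx')).
by apply/eqP; rewrite eqn_leq (dim_centralizer_le3 xx') (leq_trans dim3) ?dimvS.
Qed.

(** In dimension 4, the 3-dimensional C(x) and C(x') meet in a plane, which
    contains some u outside the line of z.  As C(x) is abelian and x' lies
    outside it, u is central.  Its coordinates on x and y in C(x) do not both
    vanish: either y is the sum of a multiple of x and a central element, or x is
    central, both of which are excluded. *)
Lemma connected_centerless x x' : lie x x' != 0 ->
  forall z, (forall v, lie z v = 0) -> z = 0.
Proof.
move=> xx' z zZ; apply: contrapT => /eqP z0.
have x'x : lie x' x != 0 by rewrite lie_antisym oppr_eq0.
have [y [Cx dimCx ynot]] := connected_centralizer_dim3 xx' z0 zZ.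
have [_ [_ dimCx' _]] := connected_centralizer_dim3 x'x z0 zZ.
have [u /memv_capP[xu x'u] uz] : exists2 u,
    u \in (centralizer x :&: centralizer x')%VS & u \notin <[z]>%VS.
  apply: contrapT => all_z.
  have : (centralizer x :&: centralizer x' <= <[z]>)%VS.
    apply/subvP => u uC; apply: contrapT => /negP uz; apply: all_z.
    by exists u.
  move=> /dimvS; rewrite dim_vline z0.
  have := dimv_sum_cap (centralizer x) (centralizer x').
  rewrite dimCx dimCx' => Esum cap1.
  have := leq_add (dimvS (subvf (centralizer x + centralizer x'))) cap1.
  by rewrite Esum dimL.
have := xu; rewrite Cx => /addv_lineP[_ /addv_lineP[_ /vlineP[k ->] [l ->]] [m Eu]].
have xy : lie x y = 0.
  apply/eqP; rewrite -centralizer_line Cx; exact: addvSr.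
have uZ v : lie u v = 0.
  apply: centralizer_full.
  have Cxu : (centralizer x <= centralizer u)%VS.
    rewrite {1}Cx !subv_add !centralizer_line Eu !lieE !zZ.
    by rewrite (lie_eq0C (zZ x)) (lie_eq0C (zZ y)) xy (lie_eq0C xy) !scaler0 !addr0 eqxx.
  rewrite eqEdim subvf dimL -dimCx /=.
  rewrite (ltn_leqif (dimv_leqif_sup Cxu)).
  apply: contra xx' => /subvP/(_ x'); rewrite !mem_centralizer; apply.
  by apply/eqP/lie_eq0C/eqP; rewrite -mem_centralizer.
have ukz v : lie (u - k *: z) v = 0 by rewrite !lieE uZ zZ scaler0 subrr.
have [m0|m0] := eqVneq m 0.
  have l0 : l != 0.
    apply: contraNneq uz => l0; rewrite Eu m0 l0 !scale0r !addr0.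
    by rewrite memvZ ?memv_line.
  have := ukz x'; rewrite Eu m0 scale0r addr0 addrC addKr lieZl.
  by move=> /eqP; rewrite scaler_eq0 (negbTE l0) (negbTE xx').
apply: (ynot (- (m^-1 * l)) (m^-1 *: (u - k *: z))).
  by move=> v; rewrite lieZl ukz scaler0.
rewrite Eu scaleNr -scalerA -scalerN -scalerDr.
have -> : - (l *: x) + (k *: z + l *: x + m *: y - k *: z) = m *: y.
  by rewrite addrAC [k *: z + _]addrC addrK addKr.
by rewrite scalerA mulVf ?scale1r.
Qed.

Lemma connected_not_isolated_centerless x x' : lie x x' != 0 ->
  forall d : L, d != 0 -> exists2 y, lie d y = 0 & y \notin <[d]>%VS.
Proof.
move=> xx' d d0; have [d' dd'] : exists d', lie d d' != 0.
  apply: contrapT => nd; case/eqP: d0; apply: (connected_centerless xx') => v.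
  by apply/eqP; apply: contrapT => /negP dv; apply: nd; exists v.
have [y dy ynot] := connected_not_isolated dd'; exists y => //.
apply/vlineP => -[k Ey]; apply: (ynot k 0) => [v|]; first exact: lie0l.
by rewrite addr0.
Qed.

(** A centralizer of dimension 3 is the kernel of a map of rank one.  If C(x) has
    dimension 2, it is spanned by x and a y with C(y) <> C(x); being abelian it is
    then strictly contained in C(y). *)
Lemma connected_rank1 x x' : lie x x' != 0 ->
  exists y d, lie y d != 0 /\ forall v, exists c, lie y v = c *: lie y d.
Proof.
move=> xx'.
suff [y [d yd dim3]] : exists y, exists2 d, lie y d != 0 &
    (3 <= \dim (centralizer y))%N.
  exists y, d; split=> // v.
  have dC : d \notin centralizer y by rewrite mem_centralizer.
  have full : (centralizer y + <[d]>)%VS = fullv.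
    by apply/eqP; rewrite eqEdim subvf dimL /=; apply: leq_ltn_trans (dim_addv_line dC).
  have := memvf v; rewrite -full => /addv_lineP[u].
  by rewrite mem_centralizer => /eqP yu [c ->]; exists c; rewrite !lieE yu add0r.
have x0 : x != 0 by apply: contraNneq xx' => ->; rewrite lie0l.
have [y [[v yv] xy neq]] := connected_centralizer_neq xx'.
have [dim2|dim3] := leqP (\dim (centralizer x)) 2; last by exists x, x'.
exists y, v => //.
have yx : y \notin <[x]>%VS.
  apply/vlineP => -[k Ey]; apply: neq; apply/vspaceP => u.
  rewrite !mem_centralizer Ey lieZl scaler_eq0.
  suff /negbTE-> : k != 0 by [].
  by apply: contraNneq yv => k0; rewrite Ey k0 scale0r lie0l.
have Cx : centralizer x = (<[x]> + <[y]>)%VS.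
  apply/eqP; rewrite eq_sym eqEdim subv_add !centralizer_line liexx xy eqxx /=.
  by rewrite (leq_trans dim2) //; have := dim_addv_line yx; rewrite dim_vline x0.
have sub : (centralizer x <= centralizer y)%VS.
  by rewrite Cx subv_add !centralizer_line liexx (lie_eq0C xy) eqxx.
have lt : (\dim (centralizer x) < \dim (centralizer y))%N.
  rewrite (ltn_leqif (dimv_leqif_eq sub)); apply/eqP => E; exact: neq.
by apply: leq_ltn_trans lt; rewrite Cx; have := dim_addv_line yx; rewrite dim_vline x0.
Qed.

Lemma connected_frame x x' : lie x x' != 0 ->
  (exists a b c d : L, n21sq_frame a b c d) \/
  (exists e1 e2 e3 e4 : L, s411_frame e1 e2 e3 e4).
Proof.
move=> xx'; have [y [d [yd rk]]] := connected_rank1 xx'.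
exact: (frame_of_rank1 dimL (connected_centerless xx')
  (connected_not_isolated_centerless xx') yd rk).
Qed.

End ConnectedCommutingGraph.

(** * Distances in graphs *)

Section GraphDistance.
Variable G : sgraph.
Implicit Types x y : G.

(** Walks may stand still and revisit vertices, which spares case distinctions;
    removing stops and loops only shortens them. *)
Lemma lazy_path_gpath x p :
  path (fun x y => (x == y) || adj x y) x p ->
  exists2 q, gpath x (last x p) q & (size q <= size p)%N.
Proof.
move=> xp; suff [q xq [<- qp]] : exists2 q, path (@adj G) x q &
    last x q = last x p /\ (size q <= size p)%N.
  case/shortenP: xq => q' xq' uq' sub; exists q' => //.
  by apply: leq_trans qp; apply: uniq_leq_size => //; case/andP: uq'.
elim: p x xp => [|y p IHp] x /=; first by exists [::].
move=> /andP[+ /IHp[q yq [lq qp]]] => /orP[/eqP ->|xy].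
  by exists q => //; split=> //; apply: leqW.
by exists (y :: q); rewrite /= ?xy.
Qed.

Lemma gdiam_eq (R : realType) n :
  (forall x y, x != y -> exists2 p, gpath x y p & (size p <= n)%N) ->
  (exists x y, x != y /\ forall p, gpath x y p -> (n <= size p)%N) ->
  gdiam R G = n%:R%:E.
Proof.
move=> short [x [y [xy long]]]; apply/eqP; rewrite eq_le; apply/andP; split.
  apply: ge_ereal_sup => _ [[u v] /= uv <-].
  have [p uvp pn] := short u v uv; apply: ge_ereal_inf.
  by exists (size p)%:R%:E; [exists p|rewrite lee_fin ler_nat].
apply: le_ereal_sup_tmp; exists (gdist R x y); first by exists (x, y).
by apply: le_ereal_inf_tmp => _ [p /long np <-]; rewrite lee_fin ler_nat.
Qed.

End GraphDistance.

(** * Walks of commuting elements *)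

Section CommutingWalks.
Variables (R : fieldType) (L : lieAlgType R).
Implicit Types x y u v : L.

(** The intermediate elements may coincide with each other or with the ends. *)
Definition walk3_connected : Prop :=
  forall x y, x \notin lie_center L -> y \notin lie_center L ->
  exists u v, [/\ u \notin lie_center L, v \notin lie_center L &
    [/\ lie x u = 0, lie u v = 0 & lie v y = 0]].

(** Such elements are neither adjacent nor have a common neighbour. *)
Definition far_pair x y : Prop :=
  lie x y != 0 /\ forall u, lie x u = 0 -> lie u y = 0 -> u = 0.

Lemma walk3_gpath : walk3_connected ->
  forall x y : commuting_graph L, x != y ->
  exists2 p, gpath x y p & (size p <= 3)%N.
Proof.
move=> walk x y xy; have [u [v [uZ vZ [xu uv vy]]]] := walk _ _ (valP x) (valP y).
pose u' : commuting_graph L := exist _ u uZ.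
pose v' : commuting_graph L := exist _ v vZ.
apply: (@lazy_path_gpath _ x [:: u'; v'; y]) => /=.
by rewrite /commuting /= xu uv vy !eqxx !andbT !orbN.
Qed.

Lemma walk3_gconnected : walk3_connected -> gconnected (commuting_graph L).
Proof. by move=> walk x y /(walk3_gpath walk)[p xyp _]; exists p. Qed.

Lemma far_pair_gpath x y : far_pair x y ->
  exists x' y' : commuting_graph L,
    x' != y' /\ forall p, gpath x' y' p -> (3 <= size p)%N.
Proof.
case=> xy far.
have xZ : x \notin lie_center L by apply/noncentralP; exists y.
have yZ : y \notin lie_center L.
  by apply/noncentralP; exists x; rewrite lie_antisym oppr_eq0.
exists (exist _ x xZ), (exist _ y yZ); split.
  by apply: contraNneq xy => /(congr1 val) /= ->; rewrite liexx.
case=> [|u [|v [|w p]]] [] //=.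
- by move=> _ [xy'] _; case/eqP: xy; rewrite xy' liexx.
- move=> /andP[/andP[_ /eqP xu] _] uy _; case/eqP: xy.
  by rewrite -[y]/(val (exist _ y yZ : commuting_graph L)) -uy.
- move=> /and3P[/andP[_ /eqP xu] /andP[_ /eqP uv] _] vy _.
  have [t] := noncentralP _ (valP u); case/eqP.
  suff -> : val u = 0 by rewrite lie0l.
  apply: far => //.
  by rewrite -[y]/(val (exist _ y yZ : commuting_graph L)) -vy.
Qed.

End CommutingWalks.

Lemma gdiam_commuting_graph (R : realType) (L : lieAlgType R) (x y : L) :
  walk3_connected L -> far_pair x y -> gdiam R (commuting_graph L) = 3%:E.
Proof.
by move=> walk far; apply: gdiam_eq; [apply: walk3_gpath|apply: far_pair_gpath far].
Qed.

(** * Walks and far pairs from frames *)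

Section FrameWalks.
Variables (R : fieldType) (L : vectLieAlgType R).
Hypothesis dimL : \dim {: L} = 4%N.

(** The two summands centralize each other, so an element commutes with both of
    its components.  One goes from x to a component of x, then to a component of
    y in the other summand.  This fails only when x and y lie in the same
    summand, and then both commute with a or c. *)
Lemma n21sq_frame_walk3 (a b c d : L) : n21sq_frame a b c d -> walk3_connected L.
Proof.
move=> F; have [a0 c0 [ab cd ac] [ad bc bd]] := F.
have fr := basis_free (n21sq_frame_basis dimL F).
have center0 v : v != 0 -> v \notin lie_center L.
  move=> v0; apply/negP; rewrite inE => vZ; case/eqP: v0; move: vZ.
  have [k1 [k2 [k3 [k4 ->]]]] := free4_span v dimL fr.
  by move=> /(n21sq_frame_faithful F)[-> -> -> ->]; rewrite !scale0r !addr0.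
have cross k1 k2 k3 k4 : lie (k1 *: a + k2 *: b) (k3 *: c + k4 *: d) = 0.
  by rewrite !lieE ac ad bc bd !scaler0 !addr0.
have across k1 k2 k3 k4 := lie_eq0C (cross k1 k2 k3 k4).
have split v : exists v1 v2, [/\ v = v1 + v2,
    exists k1 k2, v1 = k1 *: a + k2 *: b & exists k3 k4, v2 = k3 *: c + k4 *: d].
  have [k1 [k2 [k3 [k4 ->]]]] := free4_span v dimL fr.
  exists (k1 *: a + k2 *: b), (k3 *: c + k4 *: d); rewrite addrA; split=> //.
    by exists k1, k2.
  by exists k3, k4.
have not0 v : v \notin lie_center L -> v != 0.
  by apply: contraNneq => ->; rewrite inE => u; rewrite lie0l.
have aC k3 k4 : lie a (k3 *: c + k4 *: d) = 0.
  by rewrite !lieE ac ad !scaler0 addr0.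
have cA k1 k2 : lie c (k1 *: a + k2 *: b) = 0.
  by rewrite !lieE (lie_eq0C ac) (lie_eq0C bc) !scaler0 addr0.
move=> x y /not0 x0 /not0 y0.
have [x1 [x2 [Ex [k1 [k2 Ex1]] [k3 [k4 Ex2]]]]] := split x.
have [y1 [y2 [Ey [l1 [l2 Ey1]] [l3 [l4 Ey2]]]]] := split y.
have x12 : lie x1 x2 = 0 by rewrite Ex1 Ex2 cross.
have y12 : lie y1 y2 = 0 by rewrite Ey1 Ey2 cross.
have x1y2 : lie x1 y2 = 0 by rewrite Ex1 Ey2 cross.
have y1x2 : lie y1 x2 = 0 by rewrite Ey1 Ex2 cross.
rewrite {}Ex {}Ey in x0 y0 *.
have [x10|x10] := eqVneq x1 0; have [y10|y10] := eqVneq y1 0.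
- exists a, a; split; rewrite ?center0 ?x10 ?y10 ?add0r //.
  by rewrite liexx Ex2 Ey2 aC (lie_eq0C (aC _ _)).
- rewrite x10 add0r in x0 *; exists x2, y1; rewrite !center0 //; split=> //.
  by rewrite liexx (lie_eq0C y1x2) lieDr liexx y12 addr0.
- rewrite y10 add0r in y0 *; exists x1, y2; rewrite !center0 //; split=> //.
  by rewrite liexx x1y2 lieDl liexx (lie_eq0C x12) addr0.
have [x20|x20] := eqVneq x2 0.
  have [y20|y20] := eqVneq y2 0.
    exists c, c; split; rewrite ?center0 ?x20 ?y20 ?addr0 //.
    by rewrite liexx Ex1 Ey1 cA (lie_eq0C (cA _ _)).
  exists x1, y2; rewrite !center0 //; split=> //; rewrite x1y2 lieDl lieDr.
  by rewrite !liexx (lie_eq0C x12) (lie_eq0C y12) !addr0.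
exists x2, y1; rewrite !center0 //; split=> //; rewrite (lie_eq0C y1x2) lieDl lieDr.
by rewrite !liexx x12 y12 !addr0.
Qed.

Lemma n21sq_frame_far_pair (a b c d : L) :
  n21sq_frame a b c d -> far_pair (a + c) (b + d).
Proof.
move=> F; have [a0 c0 [ab cd ac] [ad bc bd]] := F.
have fr := basis_free (n21sq_frame_basis dimL F).
have indep k3 k1 : k1 *: a + k3 *: c = 0 -> k1 = 0 /\ k3 = 0.
  move=> E; have [|k1_0 _ k3_0 _] := @n21sq_frame_faithful _ _ a b c d k1 0 k3 0 F.
    by move=> u; rewrite !scale0r !addr0 E lie0l.
  by [].
split.
  rewrite !lieE ab cd ad (lie_eq0C bc) addr0 add0r.
  apply/eqP => E; have [] := indep 1 1; first by rewrite !scale1r.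
  by move/eqP; rewrite oner_eq0.
move=> u; have [k1 [k2 [k3 [k4 ->]]]] := free4_span u dimL fr.
have [vb av vd cv] := n21sq_frame_brackets k1 k2 k3 k4 F.
rewrite [lie (a + c) _]lieDl [lie _ (b + d)]lieDr av cv vb vd.
move=> /indep[-> ->] /indep[-> ->].
by rewrite !scale0r !addr0.
Qed.

(** Every element commutes with a noncentral element of the span of e1 and e3,
    which is abelian. *)
Lemma s411_frame_walk3 (e1 e2 e3 e4 : L) :
  s411_frame e1 e2 e3 e4 -> walk3_connected L.
Proof.
move=> F; have [e10 [e23 e41 e42] [e12 e13 e43]] := F.
have fr := basis_free (s411_frame_basis dimL F).
have neighbour v : exists k l, [/\ k *: e1 + l *: e3 \notin lie_center L &
    lie v (k *: e1 + l *: e3) = 0].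
  have [k1 [k2 [k3 [k4 ->]]]] := free4_span v dimL fr.
  have [k4_0|k4_0] := eqVneq k4 0.
    exists 1, 0; rewrite scale1r scale0r addr0; split.
      by apply/noncentralP; exists e4; rewrite lie_antisym e41 oppr_eq0.
    by rewrite k4_0 !lieE (lie_eq0C e12) (lie_eq0C e13) scale0r !scaler0 !addr0.
  (* The e1-coordinate compensates the bracket of k2 e2 with k4 e3. *)
  exists (- k2), k4; split.
    apply/noncentralP; exists e2.
    rewrite !lieE e12 scaler0 add0r lie_antisym e23 scalerN oppr_eq0.
    by rewrite scaler_eq0 negb_or k4_0.
  rewrite !lieE e13 e23 e43 (lie_eq0C e12) (lie_eq0C e13) e41.
  by rewrite !scaler0 !addr0 !add0r !scalerA mulrN scaleNr mulrC subrr.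
move=> x y _ _.
have [k [l [uZ xu]]] := neighbour x; have [k' [l' [vZ yv]]] := neighbour y.
exists (k *: e1 + l *: e3), (k' *: e1 + l' *: e3); split=> //.
split=> //; last exact: lie_eq0C.
by rewrite !lieE e13 (lie_eq0C e13) !scaler0 !addr0.
Qed.

(** An element commuting with e4 has no component on e1 and e2; commuting with
    e2 as well, it has none on e3 and e4. *)
Lemma s411_frame_far_pair (e1 e2 e3 e4 : L) :
  s411_frame e1 e2 e3 e4 -> far_pair e4 (e4 + e2).
Proof.
move=> F; have [e10 [e23 e41 e42] [e12 e13 e43]] := F.
have fr := basis_free (s411_frame_basis dimL F).
have indep k1 k2 : k1 *: e1 + k2 *: e2 = 0 -> k1 = 0 /\ k2 = 0.
  move=> E; have [|k1_0 k2_0 _ _] := @s411_frame_faithful _ _ e1 e2 e3 e4 k1 k2 0 0 F.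
    by move=> u; rewrite !scale0r !addr0 E lie0l.
  by [].
split.
  rewrite lieDr liexx add0r e42.
  by apply: contraNneq e10 => e20; rewrite -e23 e20 lie0l.
move=> u; have [k1 [k2 [k3 [k4 ->]]]] := free4_span u dimL fr.
have [e4v ve3 e2v ve1] := s411_frame_brackets k1 k2 k3 k4 F.
move=> e4u; have [k1_0 k2_0] : k1 = 0 /\ k2 = 0 by apply: indep; rewrite -e4v.
rewrite lieDr (lie_eq0C e4u) add0r => /lie_eq0C; rewrite e2v -scaleNr.
move=> /indep[-> /eqP]; rewrite oppr_eq0 => /eqP ->.
by rewrite k1_0 k2_0 !scale0r !addr0.
Qed.

End FrameWalks.

(** * Transport of frames and conclusion *)

Section FrameTransport.
Variables (R : fieldType) (L1 L2 : lieAlgType R).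

Lemma n21sq_frame_transport (a b c d : L2) :
  lie_isomorphic L1 L2 -> n21sq_frame a b c d ->
  exists a' b' c' d' : L1, n21sq_frame a' b' c' d'.
Proof.
move=> [f [[g fK gK] fM]] [a0 c0 [ab cd ac] [ad bc bd]].
have gM x y : lie (g x) (g y) = g (lie x y).
  by apply: (can_inj fK); rewrite fM !gK.
have g0 : g 0 = 0 by rewrite -(linear0 f) fK.
exists (g a), (g b), (g c), (g d).
by split; rewrite ?gM ?ab ?cd ?ac ?ad ?bc ?bd -?g0 ?(inj_eq (can_inj gK)).
Qed.

Lemma s411_frame_transport (e1 e2 e3 e4 : L2) :
  lie_isomorphic L1 L2 -> s411_frame e1 e2 e3 e4 ->
  exists e1' e2' e3' e4' : L1, s411_frame e1' e2' e3' e4'.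
Proof.
move=> [f [[g fK gK] fM]] [e10 [e23 e41 e42] [e12 e13 e43]].
have gM x y : lie (g x) (g y) = g (lie x y).
  by apply: (can_inj fK); rewrite fM !gK.
have g0 : g 0 = 0 by rewrite -(linear0 f) fK.
exists (g e1), (g e2), (g e3), (g e4).
by split; rewrite ?gM ?e23 ?e41 ?e42 ?e12 ?e13 ?e43 -?g0 ?(inj_eq (can_inj gK)).
Qed.

End FrameTransport.

Theorem theorem30 (R : realType) :
  (forall L : vectLieAlgType R,
     \dim {: L} = 4%N -> lie_solvable L -> ~ lie_abelian L ->
     (gconnected (commuting_graph L) <->
      lie_isomorphic L (n21 R * n21 R)%type \/ lie_isomorphic L (s411 R)))
  /\ gdiam R (commuting_graph (n21 R * n21 R)%type) = 3%:E
  /\ gdiam R (commuting_graph (s411 R)) = 3%:E.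
Proof.
have dimN := dim_n21sq R; have dimS := dim_s411 R.
have frN := n21sq_model_frame R; have frS := s411_model_frame R.
split; last first.
  split.
    exact: gdiam_commuting_graph (n21sq_frame_walk3 dimN frN)
      (n21sq_frame_far_pair dimN frN).
  exact: gdiam_commuting_graph (s411_frame_walk3 dimS frS)
    (s411_frame_far_pair dimS frS).
move=> L dimL _ nabelL; split=> [conL|[iso|iso]].
- have [x [x' xx']] : exists x x' : L, lie x x' != 0.
    apply: contrapT => abelL; apply: nabelL => x y.
    by apply/eqP; apply: contrapT => /negP xy; apply: abelL; exists x, y.
  have [[a [b [c [d F]]]]|[e1 [e2 [e3 [e4 F]]]]] := connected_frame conL dimL xx'.
    by left; apply: n21sq_frame_isomorphic F frN.
  by right; apply: s411_frame_isomorphic F frS.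
- have [a [b [c [d F]]]] := n21sq_frame_transport iso frN.
  exact: walk3_gconnected (n21sq_frame_walk3 dimL F).
- have [e1 [e2 [e3 [e4 F]]]] := s411_frame_transport iso frS.
  exact: walk3_gconnected (s411_frame_walk3 dimL F).
Qed.
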